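(* Let $\mathcal{T}=\mathrm{Tri}(A,M,B)$ be a triangular ring satisfying the following conditions: (i) if $a\in A$ and $Aa=0$, then $a=0$; (ii) if $b\in B$ and $bB=0$, then $b=0$; (iii) if $a\in A$ and $aA=0$, then $a=0$. Let $T:\mathcal{T}\to\mathcal{T}$ be a map (not assumed additive) satisfying $$T(ab)=T(a)b=aT(b)$$ for all $a,b\in\mathcal{T}$. Then $T$ is additive, i.e. $T(a+b)=T(a)+T(b)$ for all $a,b\in\mathcal{T}$. Moreover, $T$ is a two-sided centralizer.
   Context: Rings are associative and not assumed to have an identity. Triangular ring: let $A$ and $B$ be rings and $M$ an $(A,B)$-bimodule such that (a) $M$ is faithful as a left $A$-module and as a right $B$-module; (b) if $m\in M$ and $AmB=0$ (i.e. $amb=0$ for all $a\in A$, $b\in B$), then $m=0$. Then $\mathcal{T}=\mathrm{Tri}(A,M,B)=\left\{\begin{pmatrix} a & m\\ 0& b\end{pmatrix} : a\in A,\ m\in M,\ b\in B\right\}$, with the usual matrix addition and multiplication, is called a triangular ring. A two-sided centralizer of a ring $R$ is an additive map $T:R\to R$ that is both a left centralizer ($T(ab)=T(a)b$ for all $a,b\in R$) and a right centralizer ($T(ab)=aT(b)$ for all $a,b\in R$). *)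

(* Defs.v *)
From HB Require Import structures.
From mathcomp Require Import all_boot all_algebra.

Set Implicit Arguments.
Unset Strict Implicit.
Unset Printing Implicit Defensive.

Import GRing.Theory.
Local Open Scope ring_scope.

Declare Scope rng_scope.
Delimit Scope rng_scope with rng.

Reserved Notation "x ** y" (at level 40, left associativity).
Reserved Notation "a **> m" (at level 40, left associativity).
Reserved Notation "m <** b" (at level 40, left associativity).

(* MathComp's ring structures all contain a unit element, so associative rings
   that need not have one are introduced on top of zmodType. *)
HB.mixin Record Zmodule_isRng R of GRing.Zmodule R := {
  rng_mul : R -> R -> R;
  rng_mulA : associative rng_mul;
  rng_mulDl : left_distributive rng_mul +%R;
  rng_mulDr : right_distributive rng_mul +%R
}.

#[short(type="rngType")]
HB.structure Definition Rng := { R of GRing.Zmodule R & Zmodule_isRng R }.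

Notation "x ** y" := (rng_mul x y) : rng_scope.
Local Open Scope rng_scope.

(* As the rings need not have a unit, no unitality is required of the
   actions. *)
HB.mixin Record Zmodule_isBimodule (A B : rngType) M of GRing.Zmodule M := {
  lact : A -> M -> M;
  ract : M -> B -> M;
  lactDl : forall (a a' : A) (m : M), lact (a + a') m = lact a m + lact a' m;
  lactDr : forall (a : A) (m m' : M), lact a (m + m') = lact a m + lact a m';
  lactA : forall (a a' : A) (m : M), lact (a ** a') m = lact a (lact a' m);
  ractDl : forall (m m' : M) (b : B), ract (m + m') b = ract m b + ract m' b;
  ractDr : forall (m : M) (b b' : B), ract m (b + b') = ract m b + ract m b';
  ractA : forall (m : M) (b b' : B), ract m (b ** b') = ract (ract m b) b';
  lractA : forall (a : A) (m : M) (b : B), ract (lact a m) b = lact a (ract m b)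
}.

#[short(type="bimodType")]
HB.structure Definition Bimodule (A B : rngType) :=
  { M of GRing.Zmodule M & Zmodule_isBimodule A B M }.

Notation "a **> m" := (lact a m) : rng_scope.
Notation "m <** b" := (ract m b) : rng_scope.

(* (a, m, b) encodes the matrix with rows (a m) and (0 b); the additive group
   structure is the componentwise one. *)
Definition Tri (A B : rngType) (M : bimodType A B) : Type := (A * M * B)%type.

HB.instance Definition _ (A B : rngType) (M : bimodType A B) :=
  GRing.Zmodule.on (Tri M).

Section TriRng.
Variables (A B : rngType) (M : bimodType A B).
Implicit Types x y z : Tri M.

Definition tri_mul x y : Tri M :=
  (x.1.1 ** y.1.1, (x.1.1 **> y.1.2) + (x.1.2 <** y.2), x.2 ** y.2).

Fact tri_mulA : associative tri_mul.
Proof.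
move=> [[a m] b] [[a' m'] b'] [[a'' m''] b'']; rewrite /tri_mul /=.
by rewrite !rng_mulA lactA ractA lactDr ractDl lractA addrA.
Qed.

Fact tri_mulDl : left_distributive tri_mul +%R.
Proof.
move=> [[a m] b] [[a' m'] b'] [[a'' m''] b'']; rewrite /tri_mul /=.
by rewrite !rng_mulDl lactDl ractDl addrACA.
Qed.

Fact tri_mulDr : right_distributive tri_mul +%R.
Proof.
move=> [[a m] b] [[a' m'] b'] [[a'' m''] b'']; rewrite /tri_mul /=.
by rewrite !rng_mulDr lactDr ractDr addrACA.
Qed.

HB.instance Definition _ :=
  Zmodule_isRng.Build (Tri M) tri_mulA tri_mulDl tri_mulDr.

End TriRng.

Record triangular (A B : rngType) (M : bimodType A B) : Prop := Triangular {
  faithful_left : forall a : A, (forall m : M, a **> m = 0) -> a = 0;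
  faithful_right : forall b : B, (forall m : M, m <** b = 0) -> b = 0;
  nondegenerate : forall m : M,
    (forall (a : A) (b : B), a **> m <** b = 0) -> m = 0
}.

Definition left_centralizer (R : rngType) (T : R -> R) : Prop :=
  forall a b : R, T (a ** b) = T a ** b.

Definition right_centralizer (R : rngType) (T : R -> R) : Prop :=
  forall a b : R, T (a ** b) = a ** T b.

Definition two_sided_centralizer (R : rngType) (T : R -> R) : Prop :=
  [/\ {morph T : a b / a + b}, left_centralizer T & right_centralizer T].

(* Main.v *)
(* Since x T(y) = T(x) y and T(y) x = y T(x) are additive in y, the defect
   T(a + b) - T(a) - T(b) annihilates the triangular ring on both sides; such
   an element vanishes. *)

Require Import Defs.
From HB Require Import structures.
From mathcomp Require Import all_boot all_algebra.

Set Implicit Arguments.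
Unset Strict Implicit.
Unset Printing Implicit Defensive.

Import GRing.Theory.
Local Open Scope ring_scope.
Local Open Scope rng_scope.

(** The identity [T x ** y = x ** T y] lets [T] be moved off a sum onto the other factor, where
    distributivity replaces additivity. So the additivity defect of [T] is killed by every
    multiplication, and [tri_annihilator] shows that only 0 is killed on both sides. *)

Lemma rng_mulBr (R : rngType) (x y z : R) : x ** (y - z) = x ** y - x ** z.
Proof. by apply: (addIr (x ** z)); rewrite -rng_mulDr !subrK. Qed.

Lemma rng_mulBl (R : rngType) (x y z : R) : (x - y) ** z = x ** z - y ** z.
Proof. by apply: (addIr (y ** z)); rewrite -rng_mulDl !subrK. Qed.

Section Bimodule.
Variables (A B : rngType) (M : bimodType A B).

Lemma ract0m (b : B) : (0 : M) <** b = 0.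
Proof. by apply: (addrI (0 <** b)); rewrite -ractDl !addr0. Qed.

Lemma ractm0 (m : M) : m <** (0 : B) = 0.
Proof. by apply: (addrI (m <** 0)); rewrite -ractDr !addr0. Qed.

End Bimodule.

(** Diagonal corners isolate the entries of [d]: left multiplication by [(a, 0, 0)] exposes the
    [A]-entry and [a **> m], right multiplication by [(0, 0, b)] the [B]-entry. *)
Lemma tri_annihilator (A B : rngType) (M : bimodType A B)
    (triM : triangular M)
    (regA : forall a : A, (forall x : A, x ** a = 0) -> a = 0)
    (regB : forall b : B, (forall y : B, b ** y = 0) -> b = 0) (d : Tri M) :
  (forall x : Tri M, x ** d = 0) -> (forall x : Tri M, d ** x = 0) -> d = 0.
Proof.
case: d => [[p m] q] xd0 dx0.
have pE : p = 0 by apply: regA => a; have [] := xd0 (a, 0, 0).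
have qE : q = 0 by apply: regB => b; have [] := dx0 (0, 0, b).
have mE : m = 0.
  (* Already [a **> m = 0], so [a **> m <** b] vanishes for every [b]. *)
  apply: (Defs.nondegenerate triM) => a b.
  have [_ am0 _] := xd0 (a, 0, 0).
  by move: am0; rewrite /= qE ractm0 addr0 => ->; rewrite ract0m.
by rewrite pE mE qE.
Qed.

Theorem theorem3p1 (A B : rngType) (M : bimodType A B) (triM : triangular M)
    (hi : forall a : A, (forall x : A, x ** a = 0) -> a = 0)
    (hii : forall b : B, (forall y : B, b ** y = 0) -> b = 0)
    (hiii : forall a : A, (forall x : A, a ** x = 0) -> a = 0)
    (T : Tri M -> Tri M)
    (hT : forall a b : Tri M, T (a ** b) = T a ** b /\ T a ** b = a ** T b) :
  (forall a b : Tri M, T (a + b) = T a + T b) /\ two_sided_centralizer T.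
Proof.
have TL a b : T (a ** b) = T a ** b by case: (hT a b).
have TC a b : T a ** b = a ** T b by case: (hT a b).
have TD a b : T (a + b) = T a + T b.
  apply/eqP; rewrite -subr_eq0; apply/eqP.
  apply: (tri_annihilator triM hi hii) => x.
    (* After [-!TC], all three terms have the left factor [T x], and they cancel by
       distributivity. *)
    by rewrite rng_mulBr rng_mulDr -!TC rng_mulDr subrr.
  by rewrite rng_mulBl rng_mulDl !TC rng_mulDl subrr.
by split=> //; split=> // a b; rewrite TL TC.
Qed.
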